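(* Let $D$ be the center of an $A_3^8(1)$-polytope in $4_{21}$. Then there is a root $d$ of $S_8$ with $D+4K_{S_8}=2d$ if and only if the $A_3^8(1)$-polytope is cornered.
   Context: $S_8$ is a del Pezzo surface obtained by blowing up $\mathbb{P}^2$ at $8$ points (with $-K_{S_8}$ ample). $\mathrm{Pic}\,S_8=\mathbb{Z}h\oplus\mathbb{Z}e_1\oplus\dots\oplus\mathbb{Z}e_8$ with intersection form $h^2=1$, $h\cdot e_i=0$, $e_i\cdot e_j=-\delta_{ij}$, and $K_{S_8}=-3h+\sum_{i=1}^8 e_i$. A line is a class $l\in\mathrm{Pic}\,S_8$ with $l^2=l\cdot K_{S_8}=-1$; $L_8$ is the set of lines, which is the vertex set of the Gosset polytope $4_{21}$ (the convex hull of $L_8$). A root of $S_8$ is a class $d$ with $d^2=-2$, $d\cdot K_{S_8}=0$. An $A_n^8(1)$-polytope in $4_{21}$ is a set of $n+1$ distinct lines in $L_8$ with pairwise intersection number $1$; its center is the sum of these lines. The vertex figure of $l\in L_8$ is $\{l'\in L_8: l'\cdot l=0\}$. An $A_n^8(1)$-polytope is cornered if there is a line $l\in L_8$ whose vertex figure contains all its lines, and uncornered otherwise. *)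

(* Defs.v *)
From mathcomp Require Import all_boot all_order all_algebra.
From mathcomp Require Import finmap.

Set Implicit Arguments.
Unset Strict Implicit.
Unset Printing Implicit Defensive.

Import GRing.Theory.
Local Open Scope ring_scope.

(* The Picard lattice of S_8: a row (a, b_1, ..., b_8) stands for the class
   a h + b_1 e_1 + ... + b_8 e_8 (see PicE). *)
Notation Pic := 'rV[int]_(1 + 8).

Definition h : Pic := row_mx 1%:M 0.
Definition e (i : 'I_8) : Pic := row_mx 0 (delta_mx 0 i).

Definition inter (x y : Pic) : int :=
  x 0 (lshift 8 0) * y 0 (lshift 8 0)
  - \sum_(i < 8) x 0 (rshift 1 i) * y 0 (rshift 1 i).

Definition K : Pic := - (h *+ 3) + \sum_(i < 8) e i.

Definition is_line (l : Pic) : Prop := inter l l = -1 /\ inter l K = -1.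

Definition is_root (d : Pic) : Prop := inter d d = -2 /\ inter d K = 0.

(* A_n^8(1)-polytopes in 4_21, identified with their vertex sets. *)
Definition is_A1_polytope (n : nat) (P : {fset Pic}) : Prop :=
  [/\ #|` P|%fset = n.+1,
      forall l, l \in P -> is_line l
    & forall l l', l \in P -> l' \in P -> l != l' -> inter l l' = 1].

Definition center (P : {fset Pic}) : Pic := \sum_(l <- P) l.

Definition in_vertex_figure (l l' : Pic) : Prop := is_line l' /\ inter l' l = 0.

Definition cornered (P : {fset Pic}) : Prop :=
  exists l, is_line l /\ forall l', l' \in P -> in_vertex_figure l l'.

Lemma inter_hh : inter h h = 1.
Proof.
rewrite /inter /h !row_mxEl !mxE big1 ?subr0 // => i _.
by rewrite !row_mxEr !mxE mul0r.
Qed.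

Lemma inter_he i : inter h (e i) = 0.
Proof.
rewrite /inter /h /e !row_mxEl !mxE mulr0 big1 ?subr0 // => j _.
by rewrite !row_mxEr !mxE mul0r.
Qed.

Lemma inter_ee i j : inter (e i) (e j) = - (i == j)%:R.
Proof.
rewrite /inter /e !row_mxEl !mxE mulr0 sub0r (bigD1 i) //= big1 ?addr0.
  by rewrite !row_mxEr !mxE !eqxx mul1r.
by move=> k /negPf nki; rewrite !row_mxEr !mxE nki andbF mul0r.
Qed.

Lemma PicE (x : Pic) :
  x = h *~ x 0 (lshift 8 0) + \sum_(i < 8) e i *~ x 0 (rshift 1 i).
Proof.
apply/rowP => k; rewrite mxE summxE -[h *~ _]scaler_int mxE.
under eq_bigr do rewrite -scaler_int mxE.
rewrite /h /e -(splitK k); case: (split k) => j /=.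
  rewrite row_mxEl big1 ?addr0.
    by rewrite mxE (ord1 j) eqxx mulr1 intz.
  by move=> i _; rewrite row_mxEl mxE mulr0.
rewrite row_mxEr mxE mulr0 add0r (bigD1 j) //= big1 ?addr0.
  by rewrite row_mxEr mxE !eqxx mulr1 intz.
by move=> i /negPf nij; rewrite row_mxEr mxE eq_sym nij andbF mulr0.
Qed.

(* Main.v *)
Require Import Defs.
From mathcomp Require Import all_boot all_order all_algebra.
From mathcomp Require Import finmap.
From HB Require Import structures.
From mathcomp Require Import zify ring.

Set Implicit Arguments.
Unset Strict Implicit.

Import GRing.Theory.
Local Open Scope ring_scope.

(** As K^2 = 1, the map l |-> l + K is a bijection from lines to roots, the
    roots being the vectors of norm -2 in the orthogonal of K (a lattice of
    type E_8, negative definite).  It shifts intersection numbers by -1, so an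
    A_3(1)-polytope {l_1, ..., l_4} becomes four pairwise orthogonal roots
    r_1, ..., r_4, with r_1 + ... + r_4 = D + 4K, and the polytope is cornered
    exactly when some root r satisfies r.r_i = -1 for every i.

    If r_1 + ... + r_4 = 2d, then 2 d.r_i = r_i^2 = -2, so the root d is such
    an r, and the line d - K is a corner.  Conversely, given such an r,
      (2r - (r_1 + ... + r_4))^2 = 4(-2) - 4(-4) + 4(-2) = 0,
    and definiteness of the form on the orthogonal of K (inter_K_definite)
    forces 2r = r_1 + ... + r_4. *)

Lemma interC x y : inter x y = inter y x.
Proof. by rewrite /inter mulrC; under eq_bigr do rewrite mulrC. Qed.

Fact inter_is_zmod_morphism x : zmod_morphism (inter x).
Proof.
move=> y z; rewrite /inter !mxE.
under eq_bigr do rewrite !mxE mulrBr.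
rewrite sumrB; ring.
Qed.

HB.instance Definition _ x :=
  GRing.isZmodMorphism.Build Pic int (inter x) (inter_is_zmod_morphism x).

Lemma interDr x y z : inter x (y + z) = inter x y + inter x z.
Proof. exact: raddfD. Qed.

Lemma interNr x y : inter x (- y) = - inter x y.
Proof. exact: raddfN. Qed.

Lemma interBr x y z : inter x (y - z) = inter x y - inter x z.
Proof. exact: raddfB. Qed.

Lemma interDl x y z : inter (x + y) z = inter x z + inter y z.
Proof. by rewrite ![inter _ z]interC interDr. Qed.

Lemma interBl x y z : inter (x - y) z = inter x z - inter y z.
Proof. by rewrite ![inter _ z]interC interBr. Qed.

Lemma interMnr x y n : inter x (y *+ n) = inter x y *+ n.
Proof. exact: raddfMn. Qed.

Lemma inter_sumr I (r : seq I) Q (F : I -> Pic) x :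
  inter x (\sum_(i <- r | Q i) F i) = \sum_(i <- r | Q i) inter x (F i).
Proof. exact: raddf_sum. Qed.

Lemma inter_K x :
  inter x K = - (x 0 (lshift 8 0) *+ 3) - \sum_(i < 8) x 0 (rshift 1 i).
Proof.
have interxh : inter x h = x 0 (lshift 8 0).
  rewrite /inter /h !row_mxEl !mxE eqxx mulr1 big1 ?subr0 // => i _.
  by rewrite row_mxEr mxE mulr0.
have interxe i : inter x (e i) = - x 0 (rshift 1 i).
  rewrite /inter /e row_mxEl mxE mulr0 sub0r (bigD1 i) //= big1 ?addr0.
    by rewrite row_mxEr mxE !eqxx mulr1.
  by move=> j /negPf nji; rewrite row_mxEr mxE nji andbF mulr0.
rewrite /K interDr interNr interMnr interxh inter_sumr -sumrN.
by congr (_ + _); apply: eq_bigr => i _.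
Qed.

Lemma inter_KK : inter K K = 1.
Proof.
have interhK : inter h K = - 3.
  by rewrite interDr interNr interMnr inter_hh inter_sumr big1 ?addr0 // => i _;
     exact: inter_he.
rewrite {2}/K interDr interNr interMnr inter_sumr interC interhK.
under eq_bigr => i _.
  rewrite interC interDr interNr interMnr interC inter_he inter_sumr (bigD1 i) //=.
  rewrite inter_ee eqxx big1 ?addr0; last first.
    by move=> j /negPf nji; rewrite inter_ee eq_sym nji oppr0.
  over.
by rewrite sumr_const card_ord.
Qed.

(** When x.K = 0, completing squares in the coordinates (a, b) of x gives
    9 x^2 = - a^2 - sum_i (3 b_i + a)^2; hence the form is definite on the
    orthogonal of K. *)
Lemma inter_K_definite x : inter x K = 0 -> inter x x = 0 -> x = 0.
Proof.
rewrite inter_K /inter.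
set a := x 0 (lshift 8 0); set s := \sum_i _; set q := \sum_i _ => xK xx.
have sq : \sum_(i < 8) (3 * x 0 (rshift 1 i) + a) ^+ 2 = - a ^+ 2.
  under eq_bigr => i _.
    have -> : (3 * x 0 (rshift 1 i) + a) ^+ 2
      = 9 * (x 0 (rshift 1 i) * x 0 (rshift 1 i))
        + 6 * a * x 0 (rshift 1 i) + a ^+ 2 by ring.
    over.
  rewrite !big_split /= -!mulr_sumr sumr_const card_ord -/s -/q.
  have -> : s = - (a *+ 3) by lia.
  have -> : q = a * a by lia.
  ring.
have sq_ge0 : 0 <= \sum_(i < 8) (3 * x 0 (rshift 1 i) + a) ^+ 2.
  by apply: Num.Theory.sumr_ge0 => i _; exact: Num.Theory.sqr_ge0.
have a0 : a = 0 by nia.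
have /eqP := sq; rewrite a0 expr0n oppr0 Num.Theory.psumr_eq0; last first.
  by move=> i _; exact: Num.Theory.sqr_ge0.
move=> /allP b0; apply/rowP => k; rewrite mxE -(splitK k).
case: (split k) => j /=; first by rewrite (ord1 j).
have /= := b0 j (mem_index_enum _).
by rewrite addr0 sqrf_eq0 => /eqP; lia.
Qed.

Section Center.

Variables (n : nat) (P : {fset Pic}).
Hypothesis hP : is_A1_polytope n P.

Lemma inter_center_const x c :
  (forall l, l \in P -> inter x l = c) -> inter x (center P) = c *+ n.+1.
Proof.
case: hP => cardP _ _ xc; rewrite inter_sumr big_seq (eq_bigr (fun=> c)) //.
by rewrite -big_seq big_const_seq count_predT cardP iter_addr_0.
Qed.

Lemma inter_line_center l : l \in P -> inter l (center P) = n%:R - 1.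
Proof.
case: (hP) => cardP lineP interP lP; rewrite inter_sumr.
rewrite (big_fsetD1 l) //= (lineP l lP).1 addrC; congr (_ - _).
rewrite big_seq (eq_bigr (fun=> 1)); last first.
  by move=> m; rewrite !inE => /andP[ml mP]; apply: interP; rewrite // eq_sym.
rewrite -big_seq big_const_seq count_predT iter_addr_0.
by have := cardfsD1 l P; rewrite lP cardP => -[->].
Qed.

Lemma inter_K_center : inter K (center P) = - n.+1%:R.
Proof.
case: (hP) => _ lineP _; rewrite (@inter_center_const _ (-1)) ?mulNrn //.
by move=> l /lineP[_]; rewrite interC.
Qed.

Lemma inter_center_center :
  inter (center P) (center P) = (n%:R - 1) *+ n.+1.
Proof.
by apply: inter_center_const => l lP; rewrite interC inter_line_center.
Qed.

End Center.

Lemma line_root d : is_root d -> is_line (d - K).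
Proof.
case=> dd dK; have Kd : inter K d = 0 by rewrite interC.
by split; rewrite ?(interBr _ d) !(interBl d) ?dd dK ?Kd inter_KK.
Qed.

Lemma root_line l : is_line l -> is_root (l + K).
Proof.
case=> ll lK; have Kl : inter K l = -1 by rewrite interC.
by split; rewrite ?(interDr _ l) !(interDl l) ?ll lK ?Kl inter_KK.
Qed.

Theorem proposition6 (P : {fset Pic}) (D : Pic)
    (hP : is_A1_polytope 3 P) (hD : D = center P) :
  (exists d : Pic, is_root d /\ D + K *+ 4 = d *+ 2) <-> cornered P.
Proof.
have [_ lineP _] := hP; split.
- move=> [d [rd Dd]]; exists (d - K); split; first exact: line_root.
  move=> l lP; split; first exact: lineP.
  have lK := (lineP l lP).2.
  have := congr1 (inter l) Dd.
  rewrite interDr !interMnr interBr lK hD (inter_line_center hP lP); lia.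
- move=> [l [ll lP]]; exists (l + K); split; first exact: root_line.
  have lD : inter l D = 0.
    rewrite hD (inter_center_const hP (c := 0)) ?mul0rn // => m /lP[_].
    by rewrite interC.
  have KD : inter K D = - 4 by rewrite hD (inter_K_center hP).
  have DD : inter D D = 8 by rewrite hD (inter_center_center hP).
  have [l2 lK] := ll.
  (* In terms of the root r = l + K and the roots r_i = l_i + K, the class x
     is 2r - (r_1 + ... + r_4); it is isotropic and orthogonal to K. *)
  pose x := (l - K) *+ 2 - D.
  have xl : inter x l = 0.
    by rewrite interC interBr interMnr interBr l2 lK lD.
  have xK : inter x K = 0.
    by rewrite interC interBr interMnr interBr inter_KK KD [inter K l]interC lK.
  have xD : inter x D = 0.
    by rewrite interC interBr interMnr interBr DD ![inter D _]interC lD KD.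
  have : x = 0.
    apply: inter_K_definite => //.
    by rewrite {2}/x interBr interMnr interBr xl xK xD.
  move=> /subr0_eq <-.
  by rewrite -[K *+ 4]/(K *+ (2 * 2)) mulrnA -mulrnDl [K *+ 2]mulr2n addrA subrK.
Qed.
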